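(* Let $k$ and $d$ be relatively prime positive integers with $k>2d$, and let $s$ be the element of $\mathbb{Z}_k$ such that $sd\equiv 1 \pmod k$. Let $e$ be an edge in a graph $G$. If $G-e$ is $K_{k:d}$-colorable and $G$ is not $K_{k:d}$-colorable, then $e$ lies in a cycle in $G$ whose length is congruent to $is$ modulo $k$ for some $i\in\{1,\ldots,d\}$.
   Context: Graphs are finite, simple and undirected. $G-e$ denotes the graph obtained from $G$ by deleting the edge $e$ (keeping all vertices). The circular clique $K_{k:d}$ is the graph with vertex set $\mathbb{Z}_k$ in which $i$ and $j$ are adjacent if and only if $d\le j-i\le k-d$, where $j-i$ is taken modulo $k$ as a representative in $\{0,\ldots,k-1\}$. A homomorphism from a graph $G$ to a graph $H$ is a map $\phi\colon V(G)\to V(H)$ such that $uv\in E(G)$ implies $\phi(u)\phi(v)\in E(H)$. A graph $G$ is $K_{k:d}$-colorable (equivalently, $(k,d)$-colorable) if there is a homomorphism from $G$ to $K_{k:d}$. The length of a cycle is its number of edges. *)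

(* Defs.v *)
From mathcomp Require Import all_boot all_algebra.

Set Implicit Arguments.
Unset Strict Implicit.
Unset Printing Implicit Defensive.

(* A finite simple graph is a symmetric irreflexive relation E on a finType V. *)

Definition del_edge (V : finType) (E : rel V) (x y : V) : rel V :=
  fun u v => E u v && ~~ (((u == x) && (v == y)) || ((u == y) && (v == x))).

(* The difference is taken in the ring 'Z_k and then read as its representative
   in {0, ..., k - 1}. 'Z_k is the ring of integers mod k only for k > 1. *)
Definition circ_clique (k d : nat) : rel 'Z_k :=
  fun i j => d <= (j - i)%R <= k - d.

Definition graph_hom (V W : finType) (E : rel V) (F : rel W) (f : V -> W) : Prop :=
  {homo f : u v / E u v >-> F u v}.

Definition circ_colorable (k d : nat) (V : finType) (E : rel V) : Prop :=
  exists f : V -> 'Z_k, graph_hom E (@circ_clique k d) f.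

(* A cycle is listed by its distinct vertices in cyclic order, so its number of
   edges is size c; 2 < size c excludes the empty list, which ucycle accepts,
   and single edges traversed back and forth. *)
Definition graph_cycle (V : finType) (E : rel V) (c : seq V) : Prop :=
  2 < size c /\ ucycle E c.

Definition edge_in_cycle (V : finType) (c : seq V) (x y : V) : bool :=
  [&& x \in c, y \in c & (next c x == y) || (next c y == x)].

(* Main.v *)
Require Import Defs.
From mathcomp Require Import all_boot all_algebra.

(** Fix a colouring [f] of [G - e], where [e = xy], and call an edge [uv] of
    [G - e] tight from [u] to [v] when [f v = f u + d]: such an edge is exactly
    what forbids raising the colour of [u] by one while that of [v] stays put.
    Hence adding 1 to the colours of all vertices reachable from [x] along tight
    edges gives another colouring of [G - e] ([shift_closed_hom]).

    Since [G] is not colourable, [f x - f y] is never in [d, ..., k - d]; up to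
    exchanging [x] and [y] it is one of [0, ..., d - 1]. Repeat the shift as
    long as [y] is not reachable from [x]. Each shift increases [f x - f y] by
    one, and it cannot reach [d], for then [e] would be properly coloured too.
    So at some moment, with [f x - f y = r < d], there is a tight path with some
    number [m] of edges from [x] to [y] ([shift_until_tight_path]). Summing the
    differences along it gives [m d = - r], so that the cycle closed by [e] has
    a length [m + 1] satisfying [(m + 1) d = d - r] modulo [k]. Multiplying by
    [s] gives the result with [i = d - r]. *)

Set Implicit Arguments.
Unset Strict Implicit.
Unset Printing Implicit Defensive.

Import GRing.Theory.

(** Adjacency as the existence of a natural-number difference: with it, the
    colour computations take place in the ring and need no modular reduction. *)
Lemma circ_cliqueP (k d : nat) (i j : 'Z_k) : 1 < k -> 0 < d ->
  reflect (exists2 n, d <= n <= k - d & j = (i + n%:R)%R) (circ_clique d i j).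
Proof.
move=> k_gt1 d_gt0; apply: (iffP idP) => [Dij | [n /andP[le_dn le_nk] ->]].
  by exists (j - i)%R => //; rewrite natr_Zp addrC subrK.
rewrite /circ_clique addrC addKr val_Zp_nat // modn_small ?le_dn //.
by rewrite (leq_ltn_trans le_nk) // ltn_subrL d_gt0 ltnW.
Qed.

Lemma circ_clique_sym (k d : nat) :
  1 < k -> 0 < d -> d <= k -> symmetric (@circ_clique k d).
Proof.
move=> k_gt1 d_gt0 le_dk.
suff sym i j : @circ_clique k d i j -> circ_clique d j i.
  by move=> i j; apply/idP/idP; apply: sym.
case/circ_cliqueP=> // n /andP[le_dn le_nk] ->; apply/circ_cliqueP=> //.
have le_n_k: n <= k by rewrite (leq_trans le_nk) ?leq_subr.
exists (k - n); last by rewrite natrB // pchar_Zp // sub0r addrK.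
by rewrite leq_sub2l // leq_subRL // addnC -leq_subRL // le_nk.
Qed.

Section Recolouring.

Variables (k d : nat) (V : finType) (F : rel V).
Hypotheses (k_gt1 : 1 < k) (d_gt0 : 0 < d) (le_dk : d <= k).
Hypothesis F_sym : symmetric F.
Implicit Types f : V -> 'Z_k.

Definition tight f : rel V := fun u v => F u v && (f v == f u + d%:R)%R.

Definition shift (S : pred V) f : V -> 'Z_k :=
  fun v => if S v then (f v + 1)%R else f v.

(** An edge leaving [S] is not tight, so its difference exceeds [d] and can
    afford to lose one. *)
Lemma shift_closed_hom (S : pred V) f :
    (forall u v, S u -> tight f u v -> S v) ->
  graph_hom F (@circ_clique k d) f -> graph_hom F (@circ_clique k d) (shift S f).
Proof.
move=> clS homf.
have out u v : F u v -> S u -> ~~ S v -> circ_clique d (f u + 1)%R (f v).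
  move=> Fuv Su S'v.
  have /circ_cliqueP[//|//|n /andP[le_dn le_nk] fv] := homf _ _ Fuv.
  have lt_dn: d < n.
    rewrite ltn_neqAle le_dn andbT; apply: contraNneq S'v => dn.
    by apply: (clS u) => //; rewrite /tight Fuv fv dn /=.
  apply/circ_cliqueP=> //; exists n.-1.
    by case: n lt_dn le_nk {fv le_dn} => // n; rewrite ltnS => -> /ltnW.
  by rewrite fv -addrA -mulrS prednK // (leq_trans d_gt0).
move=> u v Fuv; rewrite /shift.
case: (boolP (S u)) (boolP (S v)) => [Su | S'u] [Sv | S'v].
- have := homf _ _ Fuv.
  by rewrite /circ_clique -(addrKA 1%R (f v)) opprD [(-1 - _)%R]addrC -opprD.
- exact: out.
- by rewrite circ_clique_sym // out // F_sym.
- exact: homf.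
Qed.

Lemma tight_path_last f u p :
  path (tight f) u p -> f (last u p) = (f u + (size p * d)%:R)%R.
Proof.
elim: p u => [|v p IHp] u /=; first by rewrite addr0.
by case/andP=> /andP[_ /eqP fv] /IHp ->; rewrite fv mulSn natrD addrA.
Qed.

(** Either the repeated shift pushes the colour of [x] to [d] above that of
    [y], or a tight path stops it, whose length is known modulo [k]. *)
Lemma shift_until_tight_path (x y : V) f (r : nat) :
    graph_hom F (@circ_clique k d) f -> r <= d -> f x = (f y + r%:R)%R ->
  (exists2 g, graph_hom F (@circ_clique k d) g & g x = (g y + d%:R)%R) \/
  (exists p, [/\ path F x p, uniq (x :: p), last x p = y &
     exists i, 1 <= i <= d /\ ((size p).+1 * d)%:R%R = i%:R%R :> 'Z_k]).
Proof.
move=> homf /subnKC; move: (d - r) => n.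
elim: n => [|n IHn] in f r homf *; first by rewrite addn0 => ->; left; exists f.
move=> Dd fx; have [/connectP[p0 p0P Dy] | xNy] := boolP (connect (tight f) x y).
  right; case/shortenP: p0P Dy => p pP Up _ Dy.
  exists p; split=> //; first by apply: sub_path pP => u v /andP[].
  exists n.+1; rewrite -{1}Dd leq_addl; split=> //.
  have: (f y + (r + size p * d)%:R = f y + 0)%R.
    by rewrite natrD addrA -fx addr0 Dy -tight_path_last.
  by move/addrI; rewrite natrD mulSn -{2}Dd !natrD addrAC => ->; rewrite add0r.
pose S := connect (tight f) x.
apply: (IHn (shift S f) r.+1); last first.
- by rewrite /shift /S connect0 (negPf xNy) fx -addrA -mulrSr.
- by rewrite addSnnS.
apply: shift_closed_hom homf => u v Su /connect1; exact: connect_trans Su.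
Qed.

End Recolouring.

(** The length is at least 3 because a path with at most one edge between the
    ends of [e] would be a loop or [e] itself, neither of which is in [G - e]. *)
Lemma del_edge_path_cycle (V : finType) (E : rel V) (x y : V) (p : seq V) :
    irreflexive E -> symmetric E -> E x y ->
    path (del_edge E x y) x p -> uniq (x :: p) -> last x p = y ->
  graph_cycle E (x :: p) /\ edge_in_cycle (x :: p) x y.
Proof.
move=> E_irr E_sym Exy pP Up Dy; split; last first.
  rewrite /edge_in_cycle mem_head -Dy mem_last orbC [next _ (last x p)]next_nth mem_last.
  by rewrite index_last // nth_default ?eqxx.
split.
  case: p pP Dy {Up} => [|z [|z' p]] //= => [_ Dxy | /andP[xz _] Dzy].
    by rewrite -Dxy E_irr in Exy.
  by rewrite Dzy /del_edge !eqxx /= andbF in xz.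
rewrite /ucycle Up andbT /= rcons_path Dy E_sym Exy andbT.
by apply: sub_path pP => u v /andP[].
Qed.

Theorem theorem5 (k d : nat) (k_gt0 : 0 < k) (d_gt0 : 0 < d)
    (co_kd : coprime k d) (k_gt2d : 2 * d < k)
    (s : 'Z_k) (s_inv : (s * d%:R = 1)%R)
    (V : finType) (E : rel V) (E_sym : symmetric E) (E_irr : irreflexive E)
    (x y : V) (Exy : E x y)
    (col_del : circ_colorable k d (del_edge E x y))
    (ncol : ~ circ_colorable k d E) :
  exists c : seq V,
    [/\ graph_cycle E c, edge_in_cycle c x y &
        exists i : nat, 1 <= i <= d /\ size c = i * s %[mod k]].
Proof.
have le_ddk: d + d <= k by rewrite addnn -mul2n ltnW.
have le_dk: d <= k by apply: leq_trans le_ddk; rewrite leq_addl.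
have le_d_kd: d <= k - d by rewrite leq_subRL.
have k_gt1: 1 < k by apply: leq_trans le_ddk; rewrite (@leq_add 1 1).
have cliq_sym := circ_clique_sym k_gt1 d_gt0 le_dk.
have delC u v : del_edge E u v =2 del_edge E v u.
  by move=> a b; rewrite /del_edge orbC.
have del_sym u v : symmetric (del_edge E u v).
  by move=> a b; rewrite /del_edge E_sym orbC ![(b == _) && _]andbC.
(* Otherwise [g] would colour all of [G]. *)
have bad_e g : graph_hom (del_edge E x y) (@circ_clique k d) g ->
    ~~ circ_clique d (g x) (g y).
  move=> homg; apply/negP=> gxy; apply: ncol; exists g => u v Euv.
  have [/orP[] /andP[/eqP-> /eqP->] | not_e] :=
    boolP (((u == x) && (v == y)) || ((u == y) && (v == x))) => //.
    by rewrite cliq_sym.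
  by apply: homg; rewrite /del_edge Euv.
(* Of the two orders of the ends of [e], take one with [f u - f v < d]. *)
have [f homf] := col_del.
have [u [v [uv [r [lt_rd fu]]]]] :
    exists u v, ((u = x /\ v = y) \/ (u = y /\ v = x)) /\
    exists r, r < d /\ f u = (f v + r%:R)%R.
  have := bad_e f homf; rewrite /circ_clique negb_and -!ltnNge.
  set a := (f y - f x)%R => /orP[lt_ad | lt_ka].
    by exists y, x; split; [right | exists a; rewrite natr_Zp addrC subrK].
  exists x, y; split; [by left | exists (k - a)].
  have le_ak: a <= k by rewrite ltnW // -[ltnRHS](Zp_cast k_gt1).
  split; first by rewrite ltn_subLR // addnC -ltn_subLR.
  by rewrite natrB // pchar_Zp // natr_Zp sub0r opprB addrC subrK.
have Euv : E u v by case: uv => [[-> ->] | [-> ->]] //; rewrite E_sym.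
have del_uv : del_edge E u v =2 del_edge E x y.
  by case: uv => [[-> ->] | [-> ->]].
have homf_uv : graph_hom (del_edge E u v) (@circ_clique k d) f.
  by move=> a b; rewrite del_uv; apply: homf.
have [[g homg gu] | [p [pP Up Dv [i [i_bnd Di]]]]] :=
  shift_until_tight_path k_gt1 d_gt0 le_dk (del_sym u v) homf_uv (ltnW lt_rd) fu.
  have: circ_clique d (g v) (g u).
    by apply/circ_cliqueP=> //; exists d; rewrite ?leqnn.
  have /bad_e/negP: graph_hom (del_edge E x y) (@circ_clique k d) g.
    by move=> a b; rewrite -del_uv; apply: homg.
  by case: uv => [[-> ->] | [-> ->]] //; rewrite cliq_sym.
have [cycP e_in] := del_edge_path_cycle E_irr E_sym Euv pP Up Dv.
exists (u :: p); split=> //.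
  by case: uv e_in => [[-> ->] | [-> ->]] //; rewrite /edge_in_cycle andbCA orbC.
exists i; split=> //.
(* Multiply [(size p + 1) d = i] by the inverse [s] of [d]. *)
rewrite -!val_Zp_nat // natrM natr_Zp -Di natrM -mulrA [(d%:R * s)%R]mulrC.
by rewrite s_inv mulr1.
Qed.
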